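(* Let $\mathcal{X},\mathcal{Y},\mathcal{U},\mathcal{Z}$ be finite sets, let $(X,Y)\in\mathcal{X}\times\mathcal{Y}$ have joint distribution $P_{X,Y}$ with $P_X$ and $P_Y$ of full support, and let $f:\mathcal{X}\times\mathcal{Y}\to\mathcal{U}$ and $g:\mathcal{Y}\to\mathcal{Z}$ be deterministic. Assume the ''pairwise shared side information'' condition: for all $z\in\mathcal{Z}$ and all $x,x'\in\mathcal{X}$ there exists $y\in\mathcal{Y}$ with $g(y)=z$ and $P_{X,Y}(x,y)P_{X,Y}(x',y)>0$. Then the optimal zero-error rate satisfies $$R^*=\sum_{z\in\mathcal{Z}}P_{g(Y)}(z)\,H_\kappa(G^f_z).$$
   Context: Setting: $(X^n,Y^n)$ denotes $n$ i.i.d. copies of $(X,Y)$. An encoder observes $X^n$ and $(g(Y_t))_{t\le n}$; a decoder observes $Y^n$ and must recover $(f(X_t,Y_t))_{t\le n}$. An $(n,R_n)$-zero-error source code is a pair $\phi_e:\mathcal{X}^n\times\mathcal{Z}^n\to\{0,1\}^*$, $\phi_d:\mathcal{Y}^n\times\{0,1\}^*\to\mathcal{U}^n$ such that $\phi_e(\mathcal{X}^n\times\mathcal{Z}^n)$ is prefix-free, $R_n=\frac1n\mathbb{E}[l(\phi_e(X^n,(g(Y_t))_{t\le n}))]$ ($l$ = word length), and for all $(x^n,y^n)\in\operatorname{supp}P^n_{X,Y}$, $\phi_d(y^n,\phi_e(x^n,(g(y_t))_{t\le n}))=(f(x_t,y_t))_{t\le n}$. A rate $R$ is achievable if some sequence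 of $(n,R_n)$-zero-error codes has $\lim_n R_n=R$; $R^*$ is the infimum of achievable rates. A probabilistic graph is $(\mathcal{V},\mathcal{E},P_V)$ with a distribution $P_V$ on the vertices; a set of vertices is independent if no two of its vertices are adjacent. For a probabilistic graph $G$, let $\Gamma(G)$ be its collection of independent sets; the Körner graph entropy is $H_\kappa(G)=\min I(W;V)$, where $V\sim P_V$ and the minimum is over all conditional distributions $P_{W|V}$ of a random variable $W$ taking values in $\Gamma(G)$ such that $V\in W$ with probability one. For $z\in\mathcal{Z}$, the auxiliary graph $G^f_z$ has vertex set $\mathcal{X}$ with distribution $P_{X|g(Y)=z}$, and $x,x'$ are adjacent iff there is $y\in\mathcal{Y}$ with $g(y)=z$, $P_{X,Y}(x,y)>0$, $P_{X,Y}(x',y)>0$ and $f(x,y)\ne f(x',y)$. *)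

(* Defs.v *)
From HB Require Import structures.
From mathcomp Require Import all_boot all_order all_algebra.
From mathcomp Require Import all_classical all_reals.
From mathcomp Require Import topology normedtype sequences exp.
Import numFieldNormedType.Exports.
Set Implicit Arguments. Unset Strict Implicit. Unset Printing Implicit Defensive.
Import Order.TTheory GRing.Theory Num.Theory.
Local Open Scope ring_scope.
Local Open Scope classical_set_scope.

Section Defs.
Variable R : realType.

(* logarithm in base 2 (rates are measured in bits: codewords are binary) *)
Definition log2 (x : R) : R := ln x / ln 2.

Section GraphEntropy.
Variable V : finType.
Variable adj : rel V.
Variable p : V -> R.

Definition independent (S : {set V}) : bool :=
  [forall v in S, forall v' in S, ~~ adj v v'].

Definition marginalW (Q : V -> {set V} -> R) (w : {set V}) : R :=
  \sum_v p v * Q v w.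

(* I(W;V) in bits, with the convention 0 log 0 = 0 *)
Definition mutinf (Q : V -> {set V} -> R) : R :=
  \sum_v \sum_(w : {set V})
     (if 0 < p v * Q v w
      then p v * Q v w * log2 (Q v w / marginalW Q w) else 0).

(* admissible test channels: conditional distributions P_{W|V} such that,
   almost surely, W is an independent set containing V *)
Definition admissible (Q : V -> {set V} -> R) : Prop :=
  (forall v w, 0 <= Q v w) /\
  (forall v, \sum_(w : {set V}) Q v w = 1) /\
  (forall v w, 0 < p v -> 0 < Q v w -> independent w && (v \in w)).

Definition korner_entropy : R :=
  inf [set I | exists Q, admissible Q /\ I = mutinf Q].
End GraphEntropy.

Section Coding.
Variables X Y U Z : finType.
Variable P : X -> Y -> R.
Variable f : X -> Y -> U.
Variable g : Y -> Z.

Definition PZ (z : Z) : R := \sum_x \sum_(y | g y == z) P x y.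

Definition condX (z : Z) (x : X) : R := (\sum_(y | g y == z) P x y) / PZ z.

Definition Gadj (z : Z) : rel X := fun x x' =>
  [exists y, [&& g y == z, 0 < P x y, 0 < P x' y & f x y != f x' y]].

Definition Pn (n : nat) (xs : n.-tuple X) (ys : n.-tuple Y) : R :=
  \prod_(i < n) P (tnth xs i) (tnth ys i).

Definition encoder n := n.-tuple X -> n.-tuple Z -> seq bool.
Definition decoder n := n.-tuple Y -> seq bool -> n.-tuple U.

(* the image of the encoder is prefix-free *)
Definition prefix_free n (e : encoder n) : Prop :=
  forall a b c d, prefix (e a b) (e c d) -> e a b = e c d.

Definition zero_error n (e : encoder n) (d : decoder n) : Prop :=
  forall (xs : n.-tuple X) (ys : n.-tuple Y),
    (forall i, 0 < P (tnth xs i) (tnth ys i)) ->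
    d ys (e xs (map_tuple g ys)) = [tuple f (tnth xs i) (tnth ys i) | i < n].

Definition rate n (e : encoder n) : R :=
  n%:R^-1 * \sum_(xs : n.-tuple X) \sum_(ys : n.-tuple Y)
              Pn xs ys * (size (e xs (map_tuple g ys)))%:R.

Definition achievable (r : R) : Prop :=
  exists (e : forall n, encoder n) (d : forall n, decoder n),
    (forall n, prefix_free (e n) /\ zero_error (e n) (d n)) /\
    (fun n : nat => rate (e n)) @ \oo --> (r : R^o).

Definition Rstar : R := inf [set r | achievable r].
End Coding.
End Defs.

(* Main.v *)
(** The Körner entropy is the minimum, over distributions [q] on independent
    sets, of [E (- log2 (q {w | V \in w}))], by Gibbs' inequality.

    Converse: fix [z^n].  If two inputs share a codeword, shared side
    information forces them to be nonadjacent in every coordinate, so each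
    codeword [c] determines a box of independent sets containing all its
    preimages.  With weights [2^-|c|], of total mass at most 1 by Kraft, the
    length of the codeword of [x^n] is at least [- log2] of the total weight of
    the boxes containing [x^n], and the expectation of the latter splits along
    the coordinates by the chain rule.

    Achievability: for a rate [r] above the entropy, for each [z^n] draw
    [2^(n r)] boxes at random from the product of near-optimal distributions
    [q_z], and send the index of a box containing [x^n], or [x^n] itself if
    there is none.  The latter has probability at most
    [E ((M A)^-s)] with [M] boxes of hitting probability [A], which is
    [theta^n] with [theta < 1] for small [s > 0]. *)
Require Import Defs.
From HB Require Import structures.
From mathcomp Require Import all_boot all_order all_algebra.
From mathcomp Require Import ring lra.
From mathcomp Require Import all_classical all_reals.
From mathcomp Require Import topology normedtype sequences exp.
Import numFieldNormedType.Exports.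
Import Order.TTheory GRing.Theory Num.Theory.
Set Implicit Arguments. Unset Strict Implicit. Unset Printing Implicit Defensive.
Local Open Scope ring_scope.

(** * Sums over tuples and Kraft's inequality *)

Lemma sum_tuple_recl (R : nmodType) (T : finType) n (F : n.+1.-tuple T -> R) :
  \sum_xs F xs = \sum_x \sum_(xs : n.-tuple T) F [tuple of x :: xs].
Proof.
rewrite pair_big /= (reindex (fun a : T * n.-tuple T => [tuple of a.1 :: a.2])) //.
exists (fun xs : n.+1.-tuple T => (thead xs, [tuple of behead xs])).
  by move=> [x xs] _ /=; congr (_, _); apply: val_inj.
by move=> xs _; rewrite [RHS]tuple_eta.
Qed.

Lemma sum_prod_tuple (R : comPzRingType) (T : finType) n (F : 'I_n -> T -> R) :
  \sum_(xs : n.-tuple T) \prod_i F i (tnth xs i) = \prod_i \sum_x F i x.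
Proof.
elim: n F => [|n IH] F.
  rewrite [RHS]big_ord0 (eq_bigr (fun=> 1)) => [|xs _]; last by rewrite big_ord0.
  by rewrite sumr_const card_tuple.
rewrite sum_tuple_recl big_ord_recl -IH big_distrl /=; apply: eq_bigr => x _.
rewrite big_distrr /=; apply: eq_bigr => xs _.
rewrite big_ord_recl tnth0; congr (_ * _); apply: eq_bigr => i _.
by rewrite tnthS.
Qed.

(** Linearity of expectation under [n] i.i.d. draws from [p]; it brings the converse down to a
    single letter. *)
Lemma sum_prod_sum_tuple (R : comPzRingType) (T : finType) n (p h : T -> R) :
  \sum_x p x = 1 ->
  \sum_(xs : n.-tuple T) (\prod_i p (tnth xs i)) * (\sum_i h (tnth xs i)) =
  n%:R * \sum_x p x * h x.
Proof.
move=> p1; elim: n => [|n IH].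
  by rewrite mul0r big1 // => xs _; rewrite [X in _ * X]big_ord0 mulr0.
have E1 : \sum_(xs : n.-tuple T) \prod_i p (tnth xs i) = 1.
  by rewrite (sum_prod_tuple (fun=> p)) big1.
rewrite sum_tuple_recl.
under eq_bigr => x _.
  under eq_bigr => xs _.
    rewrite !big_ord_recl !tnth0.
    under eq_bigr => i _ do rewrite tnthS.
    under [X in _ * (_ + X)]eq_bigr => i _ do rewrite tnthS.
    rewrite mulrDr mulrAC -[X in _ + X]mulrA.
    over.
  rewrite big_split /= -!big_distrr /= E1 IH mulr1.
  over.
by rewrite big_split /= -big_distrl /= p1 mul1r -natr1 mulrDl mul1r addrC.
Qed.

(** Induction on the maximal length: without the empty word, the first bit splits [s] into two
    prefix-free lists of shorter words, each weighted by 1/2; with it, [s] is the empty word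
    alone. *)
Lemma kraft (R : numFieldType) (s : seq (seq bool)) :
  uniq s -> {in s &, forall u v, prefix u v -> u = v} ->
  \sum_(w <- s) (2^-1 : R) ^+ size w <= 1.
Proof.
have [N] := ubnP (\max_(w <- s) size w).
elim: N s => // N IH s; rewrite ltnS => sN us pf.
have [s0|s0] := boolP ([::] \in s).
  have -> : s = [:: [::]].
    apply: perm_small_eq => //; apply: uniq_perm => // w.
    rewrite inE; apply/idP/eqP => [ws|-> //].
    by apply/esym/pf => //; rewrite prefix0s.
  by rewrite big_seq1 expr0.
pose half b := [seq behead w | w <- s & ohead w == Some b].
have halfP b w : (w \in half b) = (b :: w \in s).
  apply/mapP/idP => [[[|c v]]|h].
  - by rewrite mem_filter.
  - by rewrite mem_filter /= => /andP[/eqP[->] ? ->].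
  - by exists (b :: w); rewrite // mem_filter h /= eqxx.
have bound b : \sum_(w <- half b) (2^-1 : R) ^+ size w <= 1.
  (* The maximal length drops only if [s] has a word, so the empty list is settled apart. *)
  have [e|hn] := eqVneq s [::]; first by rewrite /half e big_nil.
  apply: IH.
  - have : (0 < \max_(w <- s) size w)%N.
      case: s s0 hn {sN us pf half halfP} => // w s; rewrite inE big_cons.
      by case: w => // c w _ _; rewrite leq_max.
    move=> m0; rewrite (leq_trans _ sN) // -(prednK m0) ltnS.
    apply/bigmax_leqP_seq => w; rewrite halfP => ws _.
    by rewrite -ltnS (prednK m0) (leq_trans _ (leq_bigmax_seq _ ws _)).
  - rewrite map_inj_in_uniq ?filter_uniq // => -[|c u] [|d v];
      rewrite !mem_filter //= => /andP[/eqP[->] _] /andP[/eqP[->] _] //.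
    by move=> ->.
  - move=> u v; rewrite !halfP => us' vs' uv.
    by have := pf _ _ us' vs'; rewrite prefix_cons eqxx uv => /(_ isT) [].
have split_half b : \sum_(w <- s | ohead w == Some b) (2^-1 : R) ^+ size w =
    2^-1 * \sum_(w <- half b) (2^-1 : R) ^+ size w.
  rewrite big_map big_filter big_distrr /=; apply: eq_bigr => -[|c w] //= _.
  by rewrite exprS.
rewrite (bigID (fun w => ohead w == Some true)) /= split_half.
rewrite (_ : \sum_(w <- s | _ != _) _ =
             \sum_(w <- s | ohead w == Some false) (2^-1 : R) ^+ size w).
  rewrite split_half -mulrDr ler_pdivrMl ?ltr0n // mulr1.
  by rewrite -[2]/(1 + 1) lerD.
rewrite big_seq_cond [RHS]big_seq_cond; apply: eq_bigl => -[|[] w] //=.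
by rewrite (negbTE s0).
Qed.

(** * Dual form of the Körner entropy *)

Lemma ln2_gt0 (R : realType) : 0 < ln (2 : R).
Proof. by rewrite ln_gt0 ?ltr1n. Qed.

Lemma ln_leB1 (R : realType) (x : R) : 0 < x -> ln x <= x - 1.
Proof. by move=> x0; rewrite -{1}(subrK 1 x) addrC le_ln1Dx // ltrBrDr addrC subrr. Qed.

Lemma log2_leB1 (R : realType) (x : R) : 0 < x -> log2 x <= (x - 1) / ln 2.
Proof. by move=> x0; rewrite /log2 ler_pM2r ?invr_gt0 ?ln2_gt0 ?ln_leB1. Qed.

Lemma log2M (R : realType) (x y : R) : 0 < x -> 0 < y ->
  log2 (x * y) = log2 x + log2 y.
Proof. by move=> x0 y0; rewrite /log2 lnM // mulrDl. Qed.

Lemma log2V (R : realType) (x : R) : 0 < x -> log2 x^-1 = - log2 x.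
Proof. by move=> x0; rewrite /log2 lnV // mulNr. Qed.

Lemma le_log2 (R : realType) (x y : R) : 0 < x -> x <= y -> log2 x <= log2 y.
Proof.
move=> x0 xy; rewrite /log2 ler_pM2r ?invr_gt0 ?ln2_gt0 //.
by rewrite ler_ln // posrE // (lt_le_trans x0).
Qed.

Lemma log2_half_pow (R : realType) n : log2 ((2^-1 : R) ^+ n) = - n%:R.
Proof.
rewrite /log2 lnXn ?invr_gt0 ?ltr0n // lnV ?posrE ?ltr0n //.
by rewrite mulNrn mulNr -[_ *+ n]mulr_natr mulrAC divff ?mul1r // gt_eqF ?ln2_gt0.
Qed.

Definition cover (R : realType) (V : finType) (q : {set V} -> R) (v : V) : R :=
  \sum_(w : {set V} | v \in w) q w.

(* The Körner entropy is the minimum of [cover_cost p q] over subdistributions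
   [q] on independent sets. *)
Definition cover_cost (R : realType) (V : finType) (p : V -> R)
    (q : {set V} -> R) : R :=
  \sum_v p v * - log2 (cover q v).

Section KornerDual.
Variables (R : realType) (V : finType) (adj : rel V) (p : V -> R).
Hypotheses (p_gt0 : forall v, 0 < p v) (p_sum : \sum_v p v = 1).

(** Marginals of test channels are feasible in the dual problem: as all vertices have positive mass,
    a set of positive marginal is an output for some vertex, hence independent, and each vertex is
    covered by its own outputs. *)
Lemma marginal_cover (Q : V -> {set V} -> R) : admissible adj p Q ->
  [/\ forall w, 0 <= marginalW p Q w, \sum_w marginalW p Q w = 1,
      forall w, 0 < marginalW p Q w -> independent adj w &
      forall v, 0 < cover (marginalW p Q) v].
Proof.
move=> [Q0 [Q1 Qi]].
have q0 w : 0 <= marginalW p Q w.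
  by apply: sumr_ge0 => v _; rewrite mulr_ge0 // ltW.
split=> //.
- rewrite exchange_big /= -p_sum; apply: eq_bigr => v _.
  by rewrite -big_distrr /= Q1 mulr1.
- move=> w qw; have [v Qv] : exists v, 0 < Q v w.
    apply/existsP; apply: contraLR qw => /existsPn h; rewrite -leNgt.
    apply: sumr_le0 => v _; rewrite pmulr_rle0 //.
    by rewrite leNgt.
  by have /andP[] := Qi _ _ (p_gt0 v) Qv.
- move=> v; have [w Qv] : exists w, 0 < Q v w.
    apply/existsP; apply: contraT => /existsPn h.
    have := Q1 v; rewrite big1 ?(eqP (oner_neq0 R)) => [/esym/eqP|w _].
      by rewrite oner_eq0.
    by apply/eqP; rewrite eq_le Q0 leNgt h.
  have /andP[_ vw] := Qi _ _ (p_gt0 v) Qv.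
  rewrite /cover (bigD1 w) //= ltr_pwDl ?sumr_ge0 //.
  rewrite /marginalW (bigD1 v) //= ltr_pwDl ?mulr_gt0 //.
  by apply: sumr_ge0 => u _; rewrite mulr_ge0 // ltW.
Qed.

Lemma cover_cost_ge0 (q : {set V} -> R) :
  (forall w, 0 <= q w) -> \sum_w q w <= 1 -> (forall v, 0 < cover q v) ->
  0 <= cover_cost p q.
Proof.
move=> q0 q1 qc; apply: sumr_ge0 => v _; rewrite mulr_ge0 ?(ltW (p_gt0 v)) //.
rewrite oppr_ge0 /log2 mulr_le0_ge0 ?invr_ge0 ?(ltW (ln2_gt0 R)) // ln_le0 //.
apply: le_trans q1; rewrite /cover [leLHS]big_mkcond; apply: ler_sum => w _.
by case: ifP.
Qed.

(** For each [v], this is nonnegativity of the relative entropy of [Q v] with respect to the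
    marginal conditioned on sets containing [v]. *)
Lemma cover_cost_le_mutinf (Q : V -> {set V} -> R) : admissible adj p Q ->
  cover_cost p (marginalW p Q) <= mutinf p Q.
Proof.
move=> aQ; have [q0 q1 qi qc] := marginal_cover aQ; case: aQ => Q0 [Q1 Qi].
set q := marginalW p Q in q0 q1 qi qc *.
apply: ler_sum => v _.
(* These linear terms of [ln x <= x - 1] sum to zero over [w]; adding them makes the comparison hold
   term by term. *)
pose d w := (p v * Q v w - (if v \in w then p v * q w / cover q v else 0)) / ln 2.
have d0 : \sum_w d w = 0.
  rewrite -big_distrl /= sumrB -big_distrr /= Q1 mulr1 -big_mkcond /=.
  under [X in _ - X]eq_bigr => w _ do rewrite mulrAC.
  by rewrite -big_distrr /= -/(cover q v) divfK ?gt_eqF // subrr mul0r.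
have -> : p v * - log2 (cover q v) =
    \sum_w (p v * Q v w * - log2 (cover q v) + d w).
  by rewrite big_split /= d0 addr0 -big_distrl -big_distrr /= Q1 mulr1.
apply: ler_sum => w _; case: ifPn => [pQ|].
  have Qv : 0 < Q v w by rewrite -(pmulr_rgt0 _ (p_gt0 v)).
  have /andP[_ vw] := Qi _ _ (p_gt0 v) Qv.
  have qw : 0 < q w.
    rewrite /q /marginalW (bigD1 v) //= ltr_pwDl //.
    by apply: sumr_ge0 => u _; rewrite mulr_ge0 // ltW.
  have := log2_leB1 (divr_gt0 qw (mulr_gt0 Qv (qc v))).
  have -> : q w / (Q v w * cover q v) = (Q v w / q w * cover q v)^-1.
    by field; rewrite !gt_eqF.
  rewrite log2V ?(mulr_gt0, invr_gt0) // log2M ?divr_gt0 // => h.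
  have : p v * Q v w * - (log2 (Q v w / q w) + log2 (cover q v)) <=
         p v * Q v w * (((Q v w / q w * cover q v)^-1 - 1) / ln 2).
    by rewrite ler_pM2l.
  rewrite (_ : p v * Q v w * (((Q v w / q w * cover q v)^-1 - 1) / ln 2) = - d w).
    lra.
  rewrite /d vw; field.
  by rewrite !gt_eqF ?ln2_gt0.
rewrite -leNgt pmulr_rle0 // => Qn.
have Qvw : Q v w = 0 by apply/eqP; rewrite eq_le Qn Q0.
rewrite /d Qvw mulr0 mul0r add0r sub0r mulNr oppr_le0.
rewrite mulr_ge0 ?invr_ge0 ?(ltW (ln2_gt0 R)) //.
by case: ifP => // _; rewrite !mulr_ge0 ?invr_ge0 ?(ltW (p_gt0 v)) ?(ltW (qc v)).
Qed.

(** [inf] needs this bound, both to lie below every mutual information and to be approached by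
    them. *)
Lemma korner_lbound :
  lbound [set I | exists Q, admissible adj p Q /\ I = mutinf p Q]%classic 0.
Proof.
move=> _ [Q [aQ ->]]; apply: le_trans (cover_cost_le_mutinf aQ).
by have [q0 q1 _ qc] := marginal_cover aQ; apply: cover_cost_ge0; rewrite ?q1.
Qed.

(** Let [Q v] be [q] conditioned on containing [v]. With [m] its marginal, the mutual information is
    the cover cost plus the sum of [m w * log2 (q w / m w)] over the support of [m], which is at
    most 0 since [q] has mass at most 1. *)
Lemma korner_le_cover_cost (q : {set V} -> R) :
  (forall w, 0 <= q w) -> \sum_w q w <= 1 ->
  (forall w, 0 < q w -> independent adj w) -> (forall v, 0 < cover q v) ->
  korner_entropy adj p <= cover_cost p q.
Proof.
move=> q0 q1 qi qc.
pose Q v (w : {set V}) := if v \in w then q w / cover q v else 0.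
have Q0 v w : 0 <= Q v w by rewrite /Q; case: ifP; rewrite ?divr_ge0 ?(ltW (qc v)).
have Q1 v : \sum_w Q v w = 1.
  by rewrite -big_mkcond /= -big_distrl /= -/(cover q v) divff // gt_eqF.
have aQ : admissible adj p Q.
  split=> //; split=> // v w _; rewrite /Q; case: ifP; rewrite ?ltxx // => vw.
  by rewrite pmulr_lgt0 ?invr_gt0 // => /qi ->.
apply: (@le_trans _ _ (mutinf p Q)).
  by apply: ge_inf; [exists 0; exact: korner_lbound | exists Q].
have [m0 m1 _ _] := marginal_cover aQ.
pose m := marginalW p Q.
rewrite -subr_le0 /cover_cost /mutinf.
apply: (@le_trans _ _ (\sum_v \sum_w p v * Q v w * ((q w / m w - 1) / ln 2))).
  rewrite -sumrB; apply: ler_sum => v _.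
  have -> : p v * - log2 (cover q v) = \sum_w p v * Q v w * - log2 (cover q v).
    by rewrite -big_distrl -big_distrr /= Q1 mulr1.
  rewrite -sumrB.
  apply: ler_sum => w _; case: ifPn => [pQ|].
    have Qv : 0 < Q v w by rewrite -(pmulr_rgt0 _ (p_gt0 v)).
    have mw : 0 < m w.
      rewrite /m /marginalW (bigD1 v) //= ltr_pwDl //.
      by apply: sumr_ge0 => u _; rewrite mulr_ge0 // ltW.
    move: Qv pQ; rewrite /Q; case: ifP => [vw|]; rewrite ?ltxx // => Qv pQ.
    have qw : 0 < q w by move: Qv; rewrite pmulr_lgt0 ?invr_gt0.
    rewrite -mulrBr ler_pM2l // opprK.
    rewrite [q w / _ / _]mulrAC log2M ?divr_gt0 ?invr_gt0 // log2V //.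
    by rewrite subrK; apply: log2_leB1; rewrite divr_gt0.
  rewrite -leNgt pmulr_rle0 // => Qn.
  have -> : Q v w = 0 by apply/eqP; rewrite eq_le Qn Q0.
  by rewrite mulr0 !mul0r subr0.
rewrite exchange_big /=.
under eq_bigr do rewrite -big_distrl /=.
under eq_bigr do rewrite mulrA.
rewrite -big_distrl /= mulr_le0_ge0 ?invr_ge0 ?(ltW (ln2_gt0 R)) //.
under eq_bigr do rewrite mulrBr mulr1.
rewrite sumrB m1 subr_le0; apply: le_trans q1; apply: ler_sum => w _.
rewrite -/(marginalW p Q w) -/m.
have [->|mw] := eqVneq (m w) 0; first by rewrite mul0r.
by rewrite mulrC divfK.
Qed.

End KornerDual.

(** Labels, later codewords, may share a set; pooling their weights reduces to a weight on sets. *)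
Lemma korner_le_family_cost (R : realType) (V : finType) (adj : rel V)
    (p : V -> R) (C : Type) (s : seq C) (q : C -> R) (S : C -> {set V}) :
  (forall v, 0 < p v) -> \sum_v p v = 1 ->
  (forall c, 0 <= q c) -> \sum_(c <- s) q c <= 1 ->
  (forall c, independent adj (S c)) ->
  (forall v, 0 < \sum_(c <- s | v \in S c) q c) ->
  korner_entropy adj p <= \sum_v p v * - log2 (\sum_(c <- s | v \in S c) q c).
Proof.
move=> p0 p1 q0 q1 Si Sc.
pose q' (w : {set V}) := \sum_(c <- s | S c == w) q c.
have coverE v : cover q' v = \sum_(c <- s | v \in S c) q c.
  rewrite (partition_big S (fun w : {set V} => v \in w)) //=.
  apply: eq_bigr => w vw; apply: eq_bigl => c.
  by case: eqP => [->|]; rewrite ?vw ?andbF.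
under eq_bigr do rewrite -coverE.
apply: korner_le_cover_cost => //.
- by move=> w; apply: sumr_ge0.
- by apply: le_trans q1; rewrite [leRHS](partition_big S predT).
- move=> w; apply: contraTT => wi; rewrite /q' big_pred0 ?ltxx // => c.
  by apply: contraNF wi => /eqP <-.
- by move=> v; rewrite coverE.
Qed.

(* Chain rule: conditionally on its first coordinate, a random box covering a
   vertex of the product is again a random box over the remaining coordinates. *)
Lemma sum_korner_le_box_cost (R : realType) (V : finType) n
    (adj : 'I_n -> rel V) (p : 'I_n -> V -> R)
    (C : Type) (s : seq C) (q : C -> R) (S : 'I_n -> C -> {set V}) :
  (forall t v, 0 < p t v) -> (forall t, \sum_v p t v = 1) ->
  (forall c, 0 <= q c) -> \sum_(c <- s) q c <= 1 ->
  (forall t c, independent (adj t) (S t c)) ->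
  (forall xs : n.-tuple V,
     0 < \sum_(c <- s | [forall t, tnth xs t \in S t c]) q c) ->
  \sum_t korner_entropy (adj t) (p t) <=
  \sum_(xs : n.-tuple V) (\prod_t p t (tnth xs t)) *
    - log2 (\sum_(c <- s | [forall t, tnth xs t \in S t c]) q c).
Proof.
elim: n adj p q S => [|n IH] adj p q S p0 p1 q0 q1 Si Sc.
  rewrite big_ord0; apply: sumr_ge0 => xs _; rewrite big_ord0 mul1r oppr_ge0.
  rewrite /log2 mulr_le0_ge0 ?invr_ge0 ?(ltW (ln2_gt0 R)) // ln_le0 //.
  apply: le_trans q1; rewrite [leLHS]big_mkcond; apply: ler_sum => c _.
  by case: ifP.
pose a x := \sum_(c <- s | x \in S ord0 c) q c.
have cons_in x (xs : n.-tuple V) c :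
    [forall t, tnth [tuple of x :: xs] t \in S t c] =
    (x \in S ord0 c) && [forall t, tnth xs t \in S (lift ord0 t) c].
  apply/forallP/andP => [h|[h0 /forallP h] t].
    split; first by have := h ord0; rewrite tnth0.
    by apply/forallP => t; have := h (lift ord0 t); rewrite tnthS.
  by case: (unliftP ord0 t) => [j|] ->; rewrite ?tnth0 ?tnthS.
have a0 x : 0 < a x.
  (* Any extension of [x] would do: a box containing it has [x] in its first side. *)
  apply: lt_le_trans (Sc [tuple of x :: nseq_tuple n x]) _.
  rewrite [leLHS]big_mkcond [leRHS]big_mkcond; apply: ler_sum => c _.
  by rewrite cons_in; case: ifP => [/andP[-> _]//|_]; case: ifP.
(* Weights conditioned on having [x] in the first side. Their mass is 1, and they feed the induction
   hypothesis. *)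
pose q' x c := if x \in S ord0 c then q c / a x else 0.
have splitA x (xs : n.-tuple V) :
    \sum_(c <- s | [forall t, tnth [tuple of x :: xs] t \in S t c]) q c =
    a x * \sum_(c <- s | [forall t, tnth xs t \in S (lift ord0 t) c]) q' x c.
  rewrite big_distrr /= [LHS]big_mkcond [RHS]big_mkcond; apply: eq_bigr => c _.
  rewrite cons_in /q'; case: (x \in S ord0 c) => /=; last by rewrite mulr0 if_same.
  by rewrite mulrC divfK // gt_eqF.
have A'0 x (xs : n.-tuple V) :
    0 < \sum_(c <- s | [forall t, tnth xs t \in S (lift ord0 t) c]) q' x c.
  by rewrite -(pmulr_rgt0 _ (a0 x)) -splitA.
have step x : \sum_t korner_entropy (adj (lift ord0 t)) (p (lift ord0 t)) <=
  \sum_(xs : n.-tuple V) (\prod_t p (lift ord0 t) (tnth xs t)) *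
    - log2 (\sum_(c <- s | [forall t, tnth xs t \in S (lift ord0 t) c]) q' x c).
  apply: IH => //.
  - by move=> c; rewrite /q'; case: ifP => // _; rewrite divr_ge0 // ltW.
  - by rewrite -big_mkcond /= -big_distrl /= -/(a x) divff // gt_eqF.
rewrite big_ord_recl sum_tuple_recl.
apply: (@le_trans _ _ (\sum_x p ord0 x * (- log2 (a x) +
   \sum_(xs : n.-tuple V) (\prod_t p (lift ord0 t) (tnth xs t)) *
    - log2 (\sum_(c <- s | [forall t, tnth xs t \in S (lift ord0 t) c]) q' x c)))).
  under [leRHS]eq_bigr do rewrite mulrDr.
  rewrite big_split /= lerD ?korner_le_family_cost //.
  rewrite -[leLHS]mul1r -{1}(p1 ord0) big_distrl /=; apply: ler_sum => x _.
  by rewrite ler_pM2l.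
rewrite le_eqVlt; apply/orP; left; apply/eqP; apply: eq_bigr => x _.
have pr1 : \sum_(xs : n.-tuple V) \prod_t p (lift ord0 t) (tnth xs t) = 1.
  by rewrite (sum_prod_tuple (fun t => p (lift ord0 t))) big1.
rewrite -[- log2 (a x)]mul1r -{1}pr1 big_distrl /= -big_split big_distrr /=.
apply: eq_bigr => xs _.
rewrite splitA log2M // big_ord_recl tnth0 -mulrA; congr (_ * _).
rewrite -mulrDr opprD; congr (_ * _).
by apply: eq_bigr => t _; rewrite tnthS.
Qed.

(** * Random covering *)

(* First moment method: the bound holds on average when the entries of [cb] are
   drawn independently from [mu]. *)
Lemma random_codebook (R : realFieldType) (A B T : finType) (mu : T -> R)
    (hit : A -> T -> bool) (W : A -> R) :
  (forall t, 0 <= mu t) -> \sum_t mu t = 1 ->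
  exists cb : {ffun B -> T}, (forall b, 0 < mu (cb b)) /\
    \sum_a W a * [forall b, ~~ hit a (cb b)]%:R <=
    \sum_a W a * (1 - \sum_(t | hit a t) mu t) ^+ #|B|.
Proof.
move=> mu0 mu1.
pose pr (cb : {ffun B -> T}) := \prod_b mu (cb b).
pose miss (cb : {ffun B -> T}) := \sum_a W a * ([forall b, ~~ hit a (cb b)]%:R : R).
set rhs := \sum_a W a * (1 - _) ^+ _.
have pr0 cb : 0 <= pr cb by apply: prodr_ge0.
have pr1 : \sum_cb pr cb = 1.
  by rewrite -(bigA_distr_bigA (fun _ => mu)) big1.
have mean : \sum_cb pr cb * miss cb = rhs.
  under eq_bigr => cb _ do rewrite big_distrr.
  rewrite exchange_big; apply: eq_bigr => a _ /=.
  under eq_bigr => cb _ do rewrite mulrCA.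
  rewrite -big_distrr /=; congr (_ * _).
  have -> : 1 - \sum_(t | hit a t) mu t = \sum_t mu t * (~~ hit a t)%:R.
    rewrite -{1}mu1 (bigID (hit a)) /= addrAC subrr add0r big_mkcond.
    by apply: eq_bigr => t _; case: (hit a t); rewrite ?mulr0 ?mulr1.
  rewrite -prodr_const (bigA_distr_bigA (fun _ t => mu t * (~~ hit a t)%:R)).
  apply: eq_bigr => cb _.
  rewrite big_split /=; congr (_ * _).
  have [/forallP h|/forallPn[b hb]] := boolP [forall b, ~~ hit a (cb b)].
    by rewrite big1 // => b _; rewrite h.
  by rewrite (bigD1 b) //= (negbTE hb) mul0r.
(* Otherwise every codebook of positive probability would exceed the mean [rhs]; the average excess
   being 0, no codebook would have positive probability. *)
apply: contrapT => none.
have better cb : 0 < pr cb -> rhs < miss cb.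
  move=> pcb; rewrite ltNge; apply/negP => le_miss; apply: none; exists cb.
  split=> // b; rewrite lt_def mu0 andbT; apply: contraTneq pcb => mub.
  by rewrite /pr (bigD1 b) //= mub mul0r ltxx.
have gap0 : \sum_cb pr cb * (miss cb - rhs) = 0.
  under eq_bigr do rewrite mulrBr.
  by rewrite sumrB mean -big_distrl /= pr1 mul1r subrr.
have gap_ge0 cb : 0 <= pr cb * (miss cb - rhs).
  have [|prn] := ltP 0 (pr cb).
    by move=> pcb; rewrite mulr_ge0 // subr_ge0 ltW // better.
  by have -> : pr cb = 0; [apply/eqP; rewrite eq_le prn pr0 | rewrite mul0r].
have pr_eq0 cb : pr cb = 0.
  apply/eqP; apply: contraT => prn.
  have pcb : 0 < pr cb by rewrite lt_def prn pr0.
  have /eqP : pr cb * (miss cb - rhs) = 0.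
    by apply: (psumr_eq0P (fun cb _ => gap_ge0 cb) gap0).
  by rewrite mulf_eq0 (negbTE prn) subr_eq0 gt_eqF // better.
by move: pr1; rewrite big1 // => /esym/eqP; rewrite oner_eq0.
Qed.

(* Chernoff-style bound [(1 - A)^M <= exp (- M A) <= (M A)^-s]; unlike the first
   two expressions, the last one is multiplicative in [A = expR u]. *)
Lemma miss_pow_le (R : realType) (s u : R) M : 0 <= s <= 1 -> u <= 0 ->
  (0 < M)%N -> (1 - expR u) ^+ M <= expR (- (s * (ln M%:R + u))).
Proof.
move=> /andP[s0 s1] u0 M0.
have MR : 0 < M%:R :> R by rewrite ltr0n.
apply: (@le_trans _ _ (expR (- expR u) ^+ M)).
  rewrite lerXn2r ?nnegrE ?expR_ge0 ?subr_ge0 ?expR_le1 //.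
  exact: expR_ge1Dx.
rewrite -expRM_natl ler_expR mulrN lerN2.
have -> : M%:R * expR u = expR (ln M%:R + u) by rewrite expRD lnK.
set v := _ + u.
have [v0|v0] := leP v 0.
  by apply: le_trans (expR_ge0 v); rewrite mulr_ge0_le0.
apply: (@le_trans _ _ v); first by rewrite ler_piMl // ltW.
by apply: le_trans (expR_ge1Dx v); rewrite lerDr.
Qed.

(** [expR (- x) >= 1 - x] gives [expR x <= (1 - x)^-1], whose remainder [x ^+ 2 / (1 - x)] after
    [1 + x] is at most [2 * x ^+ 2]. *)
Lemma expR_le_quadratic (R : realType) (x : R) : 0 <= x <= 2^-1 ->
  expR x <= 1 + x + 2 * x ^+ 2.
Proof.
move=> /andP[x0 x1]; have x2 : 0 < 1 - x by lra.
apply: (@le_trans _ _ (1 - x)^-1).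
  rewrite -[x in leLHS]opprK expRN lef_pV2 ?posrE ?expR_gt0 //.
  exact: expR_ge1Dx.
rewrite -[leLHS]mul1r ler_pdivrMr //.
have : 0 <= x ^+ 2 * (1 - 2 * x) by rewrite mulr_ge0 ?sqr_ge0 //; lra.
by nra.
Qed.

(** To first order in [s] the sides are [1 + s * h] and [1 + s * r] with [h < r], so a small [s]
    works; it will make the miss probability decay exponentially. *)
Lemma exponential_moment_lt (R : realType) (I : finType) (w u : I -> R) (r : R) :
  (forall i, 0 <= w i) -> \sum_i w i = 1 -> (forall i, 0 <= u i) ->
  \sum_i w i * u i < r ->
  exists2 s : R, 0 <= s <= 1 & \sum_i w i * expR (s * u i) < expR (s * r).
Proof.
move=> w0 w1 u0; set h := \sum_i _ => hr.
pose b := 1 + \sum_i u i.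
have b1 : 1 <= b by rewrite lerDl sumr_ge0.
have ub i : u i <= b.
  by rewrite /b (bigD1 i) //= addrCA lerDl addr_ge0 // sumr_ge0.
pose k := r - h; have k0 : 0 < k by rewrite subr_gt0.
(* In [s = k / c], the term [2 * b * k] ensures [s * b <= 1/2], the range of the quadratic bound,
   and [4 * b ^+ 2] keeps the second-order error below [s * k]. *)
pose c := 4 * b ^+ 2 + 2 * b * k.
have bk : 0 < b * k by rewrite mulr_gt0 // (lt_le_trans ltr01).
have b2 : 1 <= b ^+ 2 by rewrite exprn_ege1.
have c0 : 0 < c by rewrite /c; nra.
pose s := k / c.
have s0 : 0 < s by rewrite divr_gt0.
have sc : s * c = k by rewrite divfK // gt_eqF.
have sb : s * b <= 2^-1.
  by rewrite /s mulrAC ler_pdivrMr // /c; nra.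
have sb2 : 2 * s * b ^+ 2 < k.
  have : 0 < s * (b * k) by rewrite mulr_gt0.
  have : 0 < s * b ^+ 2 by rewrite mulr_gt0 // (lt_le_trans ltr01).
  by move: sc; rewrite /c; lra.
exists s.
  rewrite (ltW s0) /=; apply: (@le_trans _ _ (s * b)); last by lra.
  by rewrite ler_peMr // ltW.
apply: (@le_lt_trans _ _ (1 + (s * h + 2 * s ^+ 2 * b ^+ 2))); last first.
  apply: le_lt_trans (expR_ge1Dx _) _; rewrite ltr_expR.
  have : s * (2 * s * b ^+ 2) < s * k by rewrite ltr_pM2l.
  by rewrite /k; lra.
apply: (@le_trans _ _ (\sum_i (w i + (s * (w i * u i) + w i * (2 * s ^+ 2 * b ^+ 2))))).
  apply: ler_sum => i _.
  have su : s * u i <= s * b by rewrite ler_pM2l.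
  have su0 : 0 <= s * u i by rewrite mulr_ge0 // ltW.
  have su2 : 0 <= s * u i <= 2^-1 by rewrite su0 (le_trans su).
  have : w i * expR (s * u i) <= w i * (1 + s * u i + 2 * (s * b) ^+ 2).
    rewrite ler_wpM2l // (le_trans (expR_le_quadratic su2)) // lerD2l.
    by rewrite ler_pM2l ?ltr0n // lerXn2r ?nnegrE // (le_trans su0).
  by move=> /le_trans; apply; rewrite le_eqVlt; apply/orP; left; apply/eqP; ring.
by rewrite !big_split /= w1 -big_distrr -big_distrl /= w1 mul1r.
Qed.

Lemma injection_to_words (T : finType) k : (#|T| <= 2 ^ k)%N ->
  exists h : T -> k.-tuple bool, injective h.
Proof.
rewrite -card_bool -card_tuple => le; exists (enum_val \o widen_ord le \o enum_rank).
move=> x y /= /enum_val_inj /(congr1 val) /= /val_inj; exact: enum_rank_inj.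
Qed.

(** * Zero-error codes with shared side information *)

(** Yields elements of [X] and [Z], which are not assumed inhabited. *)
Lemma inhabited_sum1 (R : nzRingType) (I : finType) (F : I -> R) :
  \sum_i F i = 1 -> exists i : I, true.
Proof.
case: (pickP (xpredT : pred I)) => [i _|h]; first by exists i.
by rewrite big_pred0 // => /esym/eqP; rewrite oner_eq0.
Qed.

Section SharedSideInformation.
Variables (R : realType) (X Y U Z : finType).
Variables (P : X -> Y -> R) (f : X -> Y -> U) (g : Y -> Z).
Hypotheses (P_ge0 : forall x y, 0 <= P x y) (P_sum : \sum_x \sum_y P x y = 1).
Hypothesis shared :
  forall (z : Z) (x x' : X), exists y, g y = z /\ 0 < P x y * P x' y.

Definition jointXZ (x : X) (z : Z) : R := \sum_(y | g y == z) P x y.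

Lemma sharedP z x x' : exists y, [/\ g y = z, 0 < P x y & 0 < P x' y].
Proof.
have [y [gy Pxx']] := shared z x x'; exists y.
have Px : 0 < P x y.
  rewrite lt_def P_ge0 andbT; apply: contraTneq Pxx' => ->.
  by rewrite mul0r ltxx.
by split; rewrite // -(pmulr_rgt0 _ Px).
Qed.

Lemma jointXZ_gt0 x z : 0 < jointXZ x z.
Proof.
have [y [gy Pxy _]] := sharedP z x x.
by rewrite /jointXZ (bigD1 y) ?gy //= ltr_pwDl // sumr_ge0.
Qed.

Lemma PZ_gt0 z : 0 < PZ P g z.
Proof.
have [x _] := inhabited_sum1 P_sum; rewrite /PZ (bigD1 x) //= ltr_pwDl ?jointXZ_gt0 //.
by apply: sumr_ge0 => x' _; rewrite ltW ?jointXZ_gt0.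
Qed.

Lemma PZ_sum : \sum_z PZ P g z = 1.
Proof.
rewrite exchange_big -P_sum /=; apply: eq_bigr => x _.
by rewrite [RHS](partition_big g predT).
Qed.

Lemma condX_gt0 z x : 0 < condX P g z x.
Proof. by rewrite divr_gt0 ?PZ_gt0 ?jointXZ_gt0. Qed.

Lemma condX_sum z : \sum_x condX P g z x = 1.
Proof. by rewrite -big_distrl /= divff // gt_eqF ?PZ_gt0. Qed.

Lemma jointXZE x z : jointXZ x z = PZ P g z * condX P g z x.
Proof. by rewrite mulrC divfK // gt_eqF ?PZ_gt0. Qed.

(** * Rates averaged over the side information, and the converse *)

(** The encoder sees [ys] only through [g], so [ys] is summed over the fibres of [map_tuple g],
    where the probability factors along the coordinates. *)
Lemma rateE n (e : encoder X Z n) : rate P g e =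
  n%:R^-1 * \sum_(zs : n.-tuple Z) \sum_(xs : n.-tuple X)
    (\prod_i jointXZ (tnth xs i) (tnth zs i)) * (size (e xs zs))%:R.
Proof.
rewrite /rate [in RHS]exchange_big; congr (_ * _); apply: eq_bigr => xs _.
rewrite (partition_big (map_tuple g) predT) //=; apply: eq_bigr => zs _.
rewrite (eq_bigr (fun ys => Pn P xs ys * (size (e xs zs))%:R)); last first.
  by move=> ys /eqP ->.
rewrite -big_distrl /=; congr (_ * _).
under [RHS]eq_bigr => i _ do rewrite /jointXZ big_mkcond.
rewrite -(sum_prod_tuple (fun i y => if g y == tnth zs i then P (tnth xs i) y else 0)).
rewrite big_mkcond; apply: eq_bigr => ys _; case: ifPn => [/eqP <-|gz].
  by apply: eq_bigr => i _; rewrite tnth_map eqxx.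
have [i gi] : exists i, g (tnth ys i) != tnth zs i.
  apply/existsP; apply: contraNT gz => /existsPn h; apply/eqP/eq_from_tnth => i.
  by rewrite tnth_map; apply/eqP; have := h i; rewrite negbK.
by rewrite (bigD1 i) //= (negbTE gi) mul0r.
Qed.

(* Shared side information lets an adjacency in one coordinate be completed to
   a side information sequence compatible with both inputs. *)
Lemma same_codeword_nonadjacent n (e : encoder X Z n) (d : decoder Y U n)
    (zs : n.-tuple Z) (xs xs' : n.-tuple X) i :
  zero_error P f g e d -> e xs zs = e xs' zs ->
  ~~ Gadj P f g (tnth zs i) (tnth xs i) (tnth xs' i).
Proof.
move=> ze exs; apply/existsP => -[y0 /and4P[/eqP gy0 Py0 Py0' fy0]].
pose y j := sval (cid (sharedP (tnth zs j) (tnth xs j) (tnth xs' j))).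
have yP j : [/\ g (y j) = tnth zs j, 0 < P (tnth xs j) (y j) &
    0 < P (tnth xs' j) (y j)] := svalP (cid (sharedP _ _ _)).
pose ys := [tuple if j == i then y0 else y j | j < n].
have gys : map_tuple g ys = zs.
  apply: eq_from_tnth => j; rewrite tnth_map tnth_mktuple.
  by case: eqP => [->|_] //; case: (yP j).
have Pys j : 0 < P (tnth xs j) (tnth ys j).
  by rewrite tnth_mktuple; case: eqP => [->|_] //; case: (yP j).
have Pys' j : 0 < P (tnth xs' j) (tnth ys j).
  by rewrite tnth_mktuple; case: eqP => [->|_] //; case: (yP j).
(* Both inputs fit [ys] and share a codeword, so the decoder returns one tuple for both, against
   [fy0] at [i]. *)
have := ze _ _ Pys; rewrite gys exs -gys (ze _ _ Pys').
move=> /(congr1 (fun t => tnth t i)); rewrite !tnth_mktuple eqxx => fE.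
by rewrite fE eqxx in fy0.
Qed.

(** For fixed [zs], [sum_korner_le_box_cost] is applied with codewords as labels, weighted as in
    Kraft's inequality; the sides of the box of [c] are the projections of its preimages. *)
Lemma korner_le_expected_length n (e : encoder X Z n) (d : decoder Y U n) zs :
  prefix_free e -> zero_error P f g e d ->
  \sum_i korner_entropy (Gadj P f g (tnth zs i)) (condX P g (tnth zs i)) <=
  \sum_(xs : n.-tuple X)
    (\prod_i condX P g (tnth zs i) (tnth xs i)) * (size (e xs zs))%:R.
Proof.
move=> pf ze.
(* Inputs may share a codeword, while Kraft's inequality counts each word once. *)
pose s := undup [seq e xs zs | xs : n.-tuple X].
pose q (c : seq bool) : R := 2^-1 ^+ size c.
pose S i c := [set tnth xs i | xs : n.-tuple X & e xs zs == c].
have q0 c : 0 < q c by rewrite exprn_gt0 // invr_gt0 ltr0n.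
have exs_in xs : e xs zs \in s by rewrite mem_undup map_f // mem_enum.
have q_le xs : q (e xs zs) <=
    \sum_(c <- s | [forall i, tnth xs i \in S i c]) q c.
  rewrite -big_filter (bigD1_seq (e xs zs)) ?filter_uniq ?undup_uniq //=.
    by rewrite lerDl sumr_ge0 // => c _; exact: ltW.
  rewrite mem_filter exs_in andbT; apply/forallP => i; apply: imset_f.
  by rewrite inE.
apply: le_trans (@sum_korner_le_box_cost _ _ _ (fun i => Gadj P f g (tnth zs i))
  (fun i => condX P g (tnth zs i)) _ s q S _ _ _ _ _ _) _.
- by move=> *; exact: condX_gt0.
- by move=> *; exact: condX_sum.
- by move=> c; exact: ltW.
- apply: kraft; first exact: undup_uniq.
  move=> u v; rewrite !mem_undup => /mapP[xs _ ->] /mapP[xs' _ ->].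
  exact: pf.
- move=> i c; apply/forall_inP => _ /imsetP[xs + ->].
  rewrite inE => /eqP ex; apply/forall_inP => _ /imsetP[xs' + ->].
  rewrite inE => /eqP ex'; apply: same_codeword_nonadjacent ze _.
  by rewrite ex ex'.
- by move=> xs; apply: lt_le_trans (q_le xs).
apply: ler_sum => xs _; apply: ler_wpM2l.
  by apply: prodr_ge0 => i _; rewrite ltW ?condX_gt0.
by rewrite lerNl -log2_half_pow; exact: le_log2 (q0 _) (q_le xs).
Qed.

Definition conditional_entropy : R :=
  \sum_(z : Z) PZ P g z * korner_entropy (Gadj P f g z) (condX P g z).

Lemma conditional_entropy_le_rate n (e : encoder X Z n) (d : decoder Y U n) :
  (0 < n)%N -> prefix_free e -> zero_error P f g e d ->
  conditional_entropy <= rate P g e.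
Proof.
move=> n0 pf ze; rewrite rateE ler_pdivlMl ?ltr0n //.
rewrite -(sum_prod_sum_tuple n _ PZ_sum); apply: ler_sum => zs _.
apply: (@le_trans _ _ ((\prod_i PZ P g (tnth zs i)) * \sum_(xs : n.-tuple X)
    (\prod_i condX P g (tnth zs i) (tnth xs i)) * (size (e xs zs))%:R)).
  apply: ler_wpM2l; last exact: korner_le_expected_length ze.
  by apply: prodr_ge0 => i _; rewrite ltW ?PZ_gt0.
rewrite big_distrr /= le_eqVlt; apply/orP; left; apply/eqP.
apply: eq_bigr => xs _; rewrite mulrA -big_split /=; congr (_ * _).
by apply: eq_bigr => i _; rewrite jointXZE.
Qed.

Lemma conditional_entropy_le_achievable r :
  achievable P f g r -> conditional_entropy <= r.
Proof.
move=> [e [d [ed er]]]; rewrite -(cvg_lim _ er) //.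
apply: limr_ge; first by apply/cvg_ex; exists r.
(* At [n = 0] the rate is 0 since [0^-1 = 0], so the bound starts at length 1. *)
exists 1%N => // n /= n0; have [pf ze] := ed n.
exact: conditional_entropy_le_rate ze.
Qed.

(** * Achievability by random covering *)

(** The channel to singletons is admissible because [Gadj] is irreflexive; nonemptiness is needed
    for [inf] to be approached. *)
Lemma korner_set_neq0 z :
  ([set I | exists Q, admissible (Gadj P f g z) (condX P g z) Q /\
     I = mutinf (condX P g z) Q] !=set0)%classic.
Proof.
pose Q x (w : {set X}) : R := (w == [set x])%:R.
exists (mutinf (condX P g z) Q), Q; split=> //; split; first by move=> x w.
split=> [x|x w _]; rewrite /Q.
  by rewrite (bigD1 [set x]) //= eqxx big1 ?addr0 // => w /negbTE ->.
case: eqP => [->|_]; rewrite ?ltxx // => _; rewrite set11 andbT.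
apply/forall_inP => _ /set1P ->; apply/forall_inP => _ /set1P ->.
by apply/existsP => -[y /and4P[_ _ _]]; rewrite eqxx.
Qed.

(** For each [z], take the marginal of a channel within [eps] of the infimum; its cover cost is at
    most the mutual information. *)
Lemma near_optimal_cover (eps : R) : 0 < eps ->
  exists q : Z -> {set X} -> R,
  [/\ forall z w, 0 <= q z w, forall z, \sum_w q z w = 1,
      forall z w, 0 < q z w -> independent (Gadj P f g z) w,
      forall z x, 0 < cover (q z) x &
      \sum_z PZ P g z * cover_cost (condX P g z) (q z) <
        conditional_entropy + eps].
Proof.
move=> eps0.
have Qz z : exists Q, admissible (Gadj P f g z) (condX P g z) Q /\
    mutinf (condX P g z) Q <
      korner_entropy (Gadj P f g z) (condX P g z) + eps.
  have [_ [Q [aQ ->]] lt] := inf_adherent eps0 (conj (korner_set_neq0 z)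
    (ex_intro _ 0 (@korner_lbound _ _ (Gadj P f g z) _ (condX_gt0 z) (condX_sum z)))).
  by exists Q.
pose Q z := sval (cid (Qz z)).
have QP z : _ := svalP (cid (Qz z)).
pose q z := marginalW (condX P g z) (Q z).
have qP z := marginal_cover (condX_gt0 z) (condX_sum z) (QP z).1.
exists q; split=> [z|z|z|z|]; try by case: (qP z).
have [z0 _] := inhabited_sum1 PZ_sum.
have -> : conditional_entropy + eps = \sum_z PZ P g z *
    (korner_entropy (Gadj P f g z) (condX P g z) + eps).
  under [RHS]eq_bigr do rewrite mulrDr.
  by rewrite big_split /= -big_distrl /= PZ_sum mul1r.
apply: ltr_sum; first by apply/hasP; exists z0; rewrite ?mem_index_enum.
move=> z _; rewrite ltr_pM2l ?PZ_gt0 //.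
exact: le_lt_trans (cover_cost_le_mutinf (condX_gt0 z) (condX_sum z) (QP z).1) (QP z).2.
Qed.

(** The decoder picks any input compatible with [ys] that has the received codeword; nonadjacency,
    tested at each symbol of [ys], gives it the same values of [f] as the true input. *)
Lemma decoder_exists n (e : encoder X Z n) :
  (forall zs xs xs', e xs zs = e xs' zs ->
     forall i, ~~ Gadj P f g (tnth zs i) (tnth xs i) (tnth xs' i)) ->
  exists d : decoder Y U n, zero_error P f g e d.
Proof.
move=> nonadj.
pose match_ ys w (xs : n.-tuple X) :=
  [forall i, 0 < P (tnth xs i) (tnth ys i)] && (e xs (map_tuple g ys) == w).
(* [x0] fills the case of no matching input, which never arises for the codeword of an input
   compatible with [ys]. *)
have [x0 _] := inhabited_sum1 P_sum.
exists (fun ys w => let xs := odflt (nseq_tuple n x0) [pick xs | match_ ys w xs] in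
          [tuple f (tnth xs i) (tnth ys i) | i < n]).
move=> xs ys Pxy; case: pickP => [xs' /andP[/forallP Pxy' /eqP ee]|/(_ xs)].
  apply: eq_from_tnth => i; rewrite !tnth_mktuple.
  have /existsPn/(_ (tnth ys i)) := nonadj _ _ _ ee i.
  by rewrite tnth_map eqxx Pxy Pxy' /= negbK => /eqP.
by rewrite /match_ eqxx andbT => /forallP.
Qed.

Lemma sum_joint_tuple n :
  \sum_(zs : n.-tuple Z) \sum_(xs : n.-tuple X)
    \prod_i jointXZ (tnth xs i) (tnth zs i) = 1.
Proof.
under eq_bigr => zs _ do
  rewrite (sum_prod_tuple (fun i x => jointXZ x (tnth zs i))).
by rewrite (sum_prod_tuple (fun _ z => PZ P g z)) big1 // => i _; exact: PZ_sum.
Qed.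

(** A leading [false] announces the [K]-bit index of a box containing [xs], a leading [true] the
    input itself. Each flag fixes the length, so the code is prefix-free, and two inputs in one box
    are nonadjacent in every coordinate. *)
Lemma covering_code n K (q : Z -> {set X} -> R) :
  (forall z w, 0 <= q z w) -> (forall z, \sum_w q z w = 1) ->
  (forall z w, 0 < q z w -> independent (Gadj P f g z) w) ->
  exists (e : encoder X Z n) (d : decoder Y U n) (miss : n.-tuple X -> n.-tuple Z -> bool),
  [/\ prefix_free e, zero_error P f g e d,
      forall xs zs, size (e xs zs) = (K.+1 + miss xs zs * (n * #|X|))%N &
      \sum_(zs : n.-tuple Z) \sum_(xs : n.-tuple X)
        (\prod_i jointXZ (tnth xs i) (tnth zs i)) * (miss xs zs)%:R <=
      \sum_(zs : n.-tuple Z) \sum_(xs : n.-tuple X)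
        (\prod_i jointXZ (tnth xs i) (tnth zs i)) *
        (1 - \prod_i cover (q (tnth zs i)) (tnth xs i)) ^+ (2 ^ K)].
Proof.
move=> q0 q1 qi.
pose hit (xs : n.-tuple X) (box : n.-tuple {set X}) :=
  [forall i, tnth xs i \in tnth box i].
have cbP (zs : n.-tuple Z) := @random_codebook R (n.-tuple X) (K.-tuple bool)
  (n.-tuple {set X}) (fun box => \prod_i q (tnth zs i) (tnth box i)) hit
  (fun xs => \prod_i jointXZ (tnth xs i) (tnth zs i)).
have {}cbP (zs : n.-tuple Z) : exists cb : {ffun K.-tuple bool -> n.-tuple {set X}},
  (forall b, 0 < \prod_i q (tnth zs i) (tnth (cb b) i)) /\
  \sum_(xs : n.-tuple X) (\prod_i jointXZ (tnth xs i) (tnth zs i)) *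
      [forall b, ~~ hit xs (cb b)]%:R <=
  \sum_(xs : n.-tuple X) (\prod_i jointXZ (tnth xs i) (tnth zs i)) *
        (1 - \prod_i cover (q (tnth zs i)) (tnth xs i)) ^+ (2 ^ K).
  have [||cb [cb0 le]] := cbP zs.
  - by move=> box; apply: prodr_ge0.
  - by rewrite (sum_prod_tuple (fun i => q (tnth zs i))) big1.
  exists cb; split=> //; apply: le_trans le _.
  rewrite le_eqVlt; apply/orP; left; apply/eqP; apply: eq_bigr => xs _.
  rewrite card_tuple card_bool; congr (_ * (1 - _) ^+ _).
  under [RHS]eq_bigr do rewrite /cover big_mkcond.
  rewrite -(sum_prod_tuple (fun i (w : {set X}) => if tnth xs i \in w then q (tnth zs i) w else 0)).
  rewrite big_mkcond; apply: eq_bigr => box _.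
  case: ifPn => [/forallP h|/forallPn[i hi]].
    by apply: eq_bigr => i _; rewrite h.
  by rewrite (bigD1 i) //= (negbTE hi) mul0r.
pose cb zs := sval (cid (cbP zs)).
(* Boxes of positive probability only have sides of positive weight, which are independent sets. *)
have cb0 zs b i : 0 < q (tnth zs i) (tnth (cb zs b) i).
  have [h _] := svalP (cid (cbP zs)); rewrite lt_def q0 andbT.
  apply: contraTneq (h b) => qi0.
  by rewrite (bigD1 i) //= qi0 mul0r ltxx.
(* Since [#|X| <= 2 ^ #|X|], [n * #|X|] bits hold an input; this crude size suffices as misses will
   be exponentially rare. The [K] further bits make the surcharge of a miss exactly [n * #|X|]. *)
have [raw raw_inj] : exists h : n.-tuple X -> (K + n * #|X|).-tuple bool, injective h.
  apply: injection_to_words; rewrite card_tuple.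
  apply: (@leq_trans (2 ^ (n * #|X|))); last by rewrite leq_exp2l ?leq_addl.
  case: n {hit cbP cb cb0} => [|n]; first by rewrite mul0n.
  by rewrite mulnC expnM leq_exp2r // ltnW // ltn_expl.
pose hits xs zs b := hit xs (cb zs b).
pose e : encoder X Z n := fun xs zs =>
  if [pick b | hits xs zs b] is Some b then false :: b else true :: raw xs.
have eP xs zs : (exists b, hits xs zs b /\ e xs zs = false :: b) \/
    ([forall b, ~~ hits xs zs b] /\ e xs zs = true :: raw xs).
  rewrite /e; case: pickP => [b hb|h]; first by left; exists b.
  by right; split=> //; apply/forallP => b; rewrite h.
have [d ze] : exists d : decoder Y U n, zero_error P f g e d.
  apply: decoder_exists => zs xs xs' ee i.
  have [[b [hb eb]]|[hb eb]] := eP xs zs;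
    have [[b' [hb' eb']]|[hb' eb']] := eP xs' zs; move: ee; rewrite eb eb' //.
    move=> [/val_inj bb]; rewrite -bb in hb'.
    have /forall_inP/(_ _ (forallP hb i))/forall_inP := qi _ _ (cb0 zs b i).
    by apply; exact: (forallP hb' i).
  move=> [/val_inj/raw_inj ->].
  by apply/existsP => -[y /and4P[_ _ _]]; rewrite eqxx.
exists e, d, (fun xs zs => [forall b, ~~ hits xs zs b]); split=> //.
- have same (u v : seq bool) : prefix u v -> size u = size v -> u = v.
    by rewrite prefixE => /eqP + uv; rewrite uv take_size.
  move=> xs zs xs' zs'.
  have [[b [_ ->]]|[_ ->]] := eP xs zs;
    have [[b' [_ ->]]|[_ ->]] := eP xs' zs'; rewrite prefix_cons //=.
    by move=> /same->; rewrite ?size_tuple.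
  by move=> /same->; rewrite ?size_tuple.
- move=> xs zs; have [[b [hb ->]]|[hb ->]] := eP xs zs.
    rewrite /= size_tuple (_ : [forall b, _] = false) ?mul0n ?addn0 //.
    by apply/negbTE/forallPn; exists b; rewrite negbK.
  by rewrite hb /= size_tuple mul1n addSn.
- by apply: ler_sum => zs _; have [_] := svalP (cid (cbP zs)).
Qed.

Lemma cover_le1 (q : {set X} -> R) x :
  (forall w, 0 <= q w) -> \sum_w q w = 1 -> cover q x <= 1.
Proof.
move=> q0 <-; rewrite /cover [leLHS]big_mkcond; apply: ler_sum => w _.
by case: ifP.
Qed.

(** [miss_pow_le] bounds each power by a product over the coordinates, so the sum over tuples
    becomes an [n]-th power. *)
Lemma miss_probability_le (q : Z -> {set X} -> R) (s : R) n K :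
  (forall z w, 0 <= q z w) -> (forall z, \sum_w q z w = 1) ->
  (forall z x, 0 < cover (q z) x) -> 0 <= s <= 1 ->
  \sum_(zs : n.-tuple Z) \sum_(xs : n.-tuple X)
    (\prod_i jointXZ (tnth xs i) (tnth zs i)) *
    (1 - \prod_i cover (q (tnth zs i)) (tnth xs i)) ^+ (2 ^ K) <=
  expR (- (s * (K%:R * ln 2))) *
  (\sum_z \sum_x jointXZ x z * expR (s * - ln (cover (q z) x))) ^+ n.
Proof.
move=> q0 q1 qc s01.
rewrite -[n in leRHS]card_ord -prodr_const.
rewrite -(sum_prod_tuple (fun _ z =>
  \sum_x jointXZ x z * expR (s * - ln (cover (q z) x)))).
rewrite big_distrr /=; apply: ler_sum => zs _.
rewrite -(sum_prod_tuple (fun i x =>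
  jointXZ x (tnth zs i) * expR (s * - ln (cover (q (tnth zs i)) x)))).
rewrite big_distrr /=; apply: ler_sum => xs _.
rewrite big_split /= mulrCA; apply: ler_wpM2l.
  by apply: prodr_ge0 => i _; rewrite ltW ?jointXZ_gt0.
pose u := \sum_i ln (cover (q (tnth zs i)) (tnth xs i)).
have -> : \prod_i cover (q (tnth zs i)) (tnth xs i) = expR u.
  by rewrite expR_sum; apply: eq_bigr => i _; rewrite lnK // posrE.
have u0 : u <= 0 by apply: sumr_le0 => i _; rewrite ln_le0 ?cover_le1.
have M0 : (0 < 2 ^ K)%N by rewrite expn_gt0.
apply: le_trans (miss_pow_le s01 u0 M0) _.
rewrite -expR_sum -expRD ler_expR natrX lnXn ?ltr0n // -big_distrr sumrN /= -/u.
by rewrite mulrDr opprD mulrN -[_ *+ K]mulr_natl.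
Qed.

(** About [n * r] index bits make misses of probability at most [theta ^+ n] with [theta < 1], so
    sending missed inputs in full does not change the limit of the rate. *)
Lemma achievable_gt_cover_cost (q : Z -> {set X} -> R) r :
  (forall z w, 0 <= q z w) -> (forall z, \sum_w q z w = 1) ->
  (forall z w, 0 < q z w -> independent (Gadj P f g z) w) ->
  (forall z x, 0 < cover (q z) x) ->
  \sum_z PZ P g z * cover_cost (condX P g z) (q z) < r ->
  achievable P f g r.
Proof.
move=> q0 q1 qi qc qr.
have r0 : 0 <= r.
  apply: le_trans (ltW qr); apply: sumr_ge0 => z _.
  apply: mulr_ge0; first by rewrite ltW ?PZ_gt0.
  by apply: cover_cost_ge0; rewrite ?q1 //; exact: condX_gt0.
have [s s01 sP] : exists2 s : R, 0 <= s <= 1 &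
    \sum_z \sum_x jointXZ x z * expR (s * - ln (cover (q z) x)) <
    expR (s * (r * ln 2)).
  (* The costs [- ln] are in nats, hence the threshold [r * ln 2]. *)
  have [|||| s s01] := @exponential_moment_lt _ _
      (fun a : Z * X => jointXZ a.2 a.1) (fun a => - ln (cover (q a.1) a.2))
      (r * ln 2).
  - by move=> a; rewrite ltW ?jointXZ_gt0.
  - rewrite -(pair_bigA _ (fun z x => jointXZ x z)) -PZ_sum.
    by apply: eq_bigr.
  - by move=> a; rewrite oppr_ge0 ln_le0 ?cover_le1.
  - rewrite -(pair_bigA _ (fun z x => jointXZ x z * - ln (cover (q z) x))) /=.
    rewrite -ltr_pdivrMr ?ln2_gt0 // (le_lt_trans _ qr) // big_distrl /=.
    rewrite le_eqVlt; apply/orP; left; apply/eqP; apply: eq_bigr => z _.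
    rewrite big_distrl big_distrr; apply: eq_bigr => x _ /=.
    by rewrite jointXZE /log2 -mulNr !mulrA.
  rewrite -(pair_bigA _ (fun z x => jointXZ x z * expR (s * - ln (cover (q z) x)))).
  by exists s.
set mgf := \sum_z _ in sP.
pose theta := expR (- (s * (r * ln 2))) * mgf.
have mgf0 : 0 <= mgf.
  apply: sumr_ge0 => z _; apply: sumr_ge0 => x _.
  by rewrite mulr_ge0 ?expR_ge0 // ltW ?jointXZ_gt0.
have theta0 : 0 <= theta by rewrite mulr_ge0 ?expR_ge0.
have theta1 : theta < 1.
  by rewrite /theta expRN mulrC ltr_pdivrMr ?expR_gt0 // mul1r.
(* Rounding up keeps the rate at least [r], as achievability asks for a limit equal to [r]. *)
pose K n := `|Num.ceil (n%:R * r)|%N.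
have nr0 n : 0 <= n%:R * r by rewrite mulr_ge0.
have KE n : (K n)%:R = (Num.ceil (n%:R * r))%:~R :> R.
  by rewrite natr_absz ger0_norm // ceil_ge0 (lt_le_trans _ (nr0 n)) // ltrN10.
have K_ge n : n%:R * r <= (K n)%:R by rewrite KE ceil_ge.
have K_lt n : (K n)%:R < n%:R * r + 1.
  by rewrite KE -ltrBlDr; have /andP[] := ceil_itv (n%:R * r); rewrite intrD.
(* Of the [2 / n], one unit pays for the rounding and one for the flag bit. *)
have codeP n : exists c : encoder X Z n * decoder Y U n,
    [/\ prefix_free c.1, zero_error P f g c.1 c.2 & (0 < n)%N ->
        r <= rate P g c.1 <= r + 2 * n%:R^-1 + #|X|%:R * theta ^+ n].
  have [e [d [miss [pf ze sz miss_le]]]] := @covering_code n (K n) q q0 q1 qi.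
  exists (e, d); split=> //= n0; have nR : 0 < n%:R :> R by rewrite ltr0n.
  set fail := (X in X <= _) in miss_le.
  have fail0 : 0 <= fail.
    apply: sumr_ge0 => zs _; apply: sumr_ge0 => xs _; apply: mulr_ge0 => //.
    by apply: prodr_ge0 => i _; rewrite ltW ?jointXZ_gt0.
  have fail_le : fail <= theta ^+ n.
    apply: le_trans miss_le _.
    apply: le_trans (miss_probability_le n (K n) q0 q1 qc s01) _.
    rewrite /theta exprMn ler_wpM2r ?exprn_ge0 // -expRM_natl ler_expR.
    have /andP[s0 _] := s01.
    rewrite mulrN lerN2 mulrCA ler_wpM2l // mulrA ler_wpM2r //.
    by rewrite ltW ?ln2_gt0.
  have -> : rate P g e = n%:R^-1 * ((K n)%:R + 1 + n%:R * #|X|%:R * fail).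
    rewrite rateE; congr (_ * _).
    have -> : (K n)%:R + 1 = \sum_(zs : n.-tuple Z) \sum_(xs : n.-tuple X)
        (\prod_i jointXZ (tnth xs i) (tnth zs i)) * (K n).+1%:R.
      under eq_bigr => zs _ do rewrite -big_distrl /=.
      by rewrite -big_distrl /= sum_joint_tuple mul1r natr1.
    rewrite big_distrr -big_split /=; apply: eq_bigr => zs _.
    rewrite big_distrr -big_split /=; apply: eq_bigr => xs _.
    by rewrite sz natrD !natrM; ring.
  have Xf : 0 <= n%:R * #|X|%:R * fail by rewrite !mulr_ge0.
  rewrite ler_pdivlMl // ler_pdivrMl //.
  have := K_ge n; have := K_lt n.
  have : n%:R * #|X|%:R * fail <= n%:R * #|X|%:R * theta ^+ n.
    by rewrite ler_wpM2l ?mulr_ge0.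
  have nV : n%:R * (2 * n%:R^-1) = 2 :> R by rewrite mulrCA divff ?mulr1 // gt_eqF.
  rewrite !mulrDr nV [n%:R * (_ * _)]mulrA.
  by move=> *; apply/andP; split; lra.
pose c n := sval (cid (codeP n)).
have cP n := svalP (cid (codeP n)).
exists (fun n => (c n).1), (fun n => (c n).2); split=> [n|]; first by case: (cP n).
(* [harmonic n] is [1 / (n + 1)], and [2 / n <= 4 / (n + 1)] once [n >= 1]. *)
apply: (@squeeze_cvgr _ _ _ _ (fun=> r) (fun n => r + 4 * harmonic n + #|X|%:R * theta ^+ n)).
- exists 1%N => // n /= n0; have [_ _ /(_ n0)/andP[-> le]] := cP n.
  apply: le_trans le _; rewrite !lerD2r lerD2l /= -[2 in leLHS]divr1.
  have nR : 1 <= n%:R :> R by rewrite ler1n.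
  rewrite divr1 ler_pdivrMr ?ltr0n // mulrAC ler_pdivlMr ?ltr0n // -natr1.
  lra.
- exact: cvg_cst.
suff : ((fun n => r + 4 * harmonic n + #|X|%:R * theta ^+ n : R) @ \oo -->
    (r + 4 * 0 + #|X|%:R * 0 : R^o))%classic by rewrite !mulr0 !addr0.
apply: cvgD; first apply: cvgD; first exact: cvg_cst.
  by apply: cvgMr; exact: cvg_harmonic.
by apply: cvgMr; apply: cvg_expr; rewrite ger0_norm.
Qed.

(** Every rate strictly above the entropy is achievable; the infimum closes the gap. *)
Lemma Rstar_eq : Rstar P f g = conditional_entropy.
Proof.
have ach eps : 0 < eps -> achievable P f g (conditional_entropy + eps).
  by move=> /near_optimal_cover[q [q0 q1 qi qc qlt]]; exact: achievable_gt_cover_cost qlt.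
apply/eqP; rewrite eq_le; apply/andP; split.
  apply/ler_addgt0Pr => eps /ach ach_eps.
  apply: ge_inf => //; exists conditional_entropy => r.
  exact: conditional_entropy_le_achievable.
apply: lb_le_inf; first by exists (conditional_entropy + 1); exact: ach.
by move=> r; exact: conditional_entropy_le_achievable.
Qed.

End SharedSideInformation.

Theorem theorem2 (R : realType) (X Y U Z : finType)
  (P : X -> Y -> R) (f : X -> Y -> U) (g : Y -> Z) :
  (forall x y, 0 <= P x y) ->
  \sum_x \sum_y P x y = 1 ->
  (forall x, 0 < \sum_y P x y) ->
  (forall y, 0 < \sum_x P x y) ->
  (forall (z : Z) (x x' : X), exists y, g y = z /\ 0 < P x y * P x' y) ->
  Rstar P f g = \sum_(z : Z) PZ P g z * korner_entropy (Gadj P f g z) (condX P g z).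
Proof. by move=> P_ge0 P_sum _ _ shared; exact: Rstar_eq. Qed.
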